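(* Let $P$ be a poset on $[n]=\{1,\dots,n\}$. Then \[ {\sf Poin}(P,t)=\sum_{\sigma\in \mathfrak{S}^{\pitchfork}(P)} t^{\,n-\operatorname{cyc}(\sigma)}, \] where $\operatorname{cyc}(\sigma)$ is the number of cycles of $\sigma$. In particular, the number of linear extensions of $P$ equals $\#\mathfrak{S}^{\pitchfork}(P)$.
   Context: Braid arrangement: in $V=\mathbb{R}^n$ let $H_{ij}=\{x: x_i=x_j\}$ for $1\le i<j\le n$. Let $\mathcal{L}$ be the set of all intersections of subsets of these hyperplanes ($V$ itself being the empty intersection), partially ordered by reverse inclusion, with Möbius function $\mu$. For a poset $P$ on $[n]$ let $\mathcal{K}_P=\{x\in\mathbb{R}^n: x_i<x_j \text{ whenever } i<_P j\}$ and $\mathcal{L}^{int}(\mathcal{K}_P)=\{X\in\mathcal{L}: X\cap\mathcal{K}_P\neq\emptyset\}$. The Whitney numbers are $c_k(P)=\sum_{X\in\mathcal{L}^{int}(\mathcal{K}_P),\ \operatorname{codim}X=k}|\mu(V,X)|$ and ${\sf Poin}(P,t)=\sum_{k\ge 0}c_k(P)t^k$. A linear extension of $P$ is a permutation $[\sigma_1,\dots,\sigma_n]$ of $[n]$ such that $i<_P j$ implies $i$ appears before $j$. For a set partition $\pi$ of $[n]$, let $P/\pi$ be the preposet on the blocks of $\pi$ which is the transitive closure of the relation $B\le B'$ whenever some $p\in B$, $q\in B'$ satisfy $p\le_P q$. $\pi$ is called $P$-transverse if every block of $\pi$ is an antichain of $P$ and $P/\pi$ is antisymmetric (a poset). A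 permutation $\sigma\in\mathfrak{S}_n$ is $P$-transverse if the set partition of $[n]$ into the cycles of $\sigma$ is $P$-transverse; $\mathfrak{S}^{\pitchfork}(P)$ denotes the set of $P$-transverse permutations. *)

(* Defs.v *)
From HB Require Import structures.
From mathcomp Require Import all_boot all_order all_fingroup all_algebra.
From mathcomp Require Import boolp reals.

Set Implicit Arguments.
Unset Strict Implicit.
Unset Printing Implicit Defensive.

Import Order.TTheory GRing.Theory Num.Theory.
Local Open Scope ring_scope.

Section Mobius.
Variables (d : Order.disp_t) (T : finPOrderType d).
Local Open Scope order_scope.

(* [k] is fuel for the recursion on the second argument; [#|T|] bounds the
   length of every chain of [T], hence the depth of the recursion. *)
Fixpoint mobius_rec (k : nat) (x y : T) : int :=
  if k is k'.+1 then
    if x == y then 1%R else (- \sum_(z : T | (x <= z < y)%O) mobius_rec k' x z)%R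
  else 0%R.

Definition mobius (x y : T) : int := mobius_rec #|T| x y.

Lemma mobius_rec_stable k l (x y : T) :
    (#|[set z : T | (x <= z < y)%O]| < k)%N -> (#|[set z : T | (x <= z < y)%O]| < l)%N ->
  mobius_rec k x y = mobius_rec l x y.
Proof.
elim: k l y => [|k IHk] [|l] y //= ltk ltl; case: eqP => // _; congr (- _)%R.
apply: eq_bigr => z /andP[xz zy].
have /proper_card ltz : [set w : T | (x <= w < z)%O] \proper [set w : T | (x <= w < y)%O].
  apply/properP; split.
    by apply/subsetP=> w; rewrite !inE => /andP[-> /lt_trans->].
  by exists z; rewrite !inE ?xz ?zy // ltxx andbF.
by apply: IHk; apply: leq_trans ltz _.
Qed.

Lemma mobiusxx x : mobius x x = 1%R.
Proof.
rewrite /mobius; case E : #|T| => [|k] /=; last by rewrite eqxx.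
by have := fintype0 x E.
Qed.

Lemma mobiusE x y : x != y ->
  mobius x y = (- \sum_(z : T | (x <= z < y)%O) mobius x z)%R.
Proof.
have ltT u v : (#|[set z : T | (u <= z < v)%O]| < #|T|)%N.
  rewrite -cardsT; apply: proper_card; apply/properP; split; first exact: subsetT.
  by exists v; rewrite !inE ?ltxx ?andbF.
move=> /negPf xy; rewrite {1}/mobius (@mobius_rec_stable _ #|T|.+1) /= ?xy //.
by rewrite ltnS ltnW.
Qed.

End Mobius.

Section Braid.
Variables (R : realType) (n : nat).
Implicit Types (x : 'rV[R]_n) (i j : 'I_n).

Definition coord_diff i j x : R^o := x 0 i - x 0 j.

Fact coord_diff_is_linear i j : linear (coord_diff i j).
Proof.
move=> a x y; rewrite /coord_diff !mxE /GRing.scale /= mulrBr opprD.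
by rewrite addrACA.
Qed.

HB.instance Definition _ i j :=
  GRing.isLinear.Build R 'rV[R]_n R^o _ (coord_diff i j) (coord_diff_is_linear i j).

Definition braid_hyp i j : {vspace 'rV[R]_n} := lker (linfun (coord_diff i j)).

Lemma mem_braid_hyp i j x : (x \in braid_hyp i j) = (x 0 i == x 0 j).
Proof. by rewrite memv_ker lfunE /= subr_eq0. Qed.

Definition braid_flats : seq {vspace 'rV[R]_n} :=
  [seq (\bigcap_(e : 'I_n * 'I_n | e \in E) braid_hyp e.1 e.2)%VS
     | E : {set 'I_n * 'I_n} in powerset [set e : 'I_n * 'I_n | (e.1 < e.2)%N]].

Definition braid_flat := seq_sub braid_flats.

HB.instance Definition _ := SubType.on braid_flat.
HB.instance Definition _ := Finite.on braid_flat.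

Definition flat_space (X : braid_flat) : {vspace 'rV[R]_n} := val X.

Lemma fullv_braid_flats : fullv \in braid_flats.
Proof.
apply/imageP; exists set0; first by rewrite powersetE sub0set.
by rewrite big_set0.
Qed.

Definition ambient_flat : braid_flat := SeqSub fullv_braid_flats.

(* Reverse inclusion. *)
Definition flat_le (X Y : braid_flat) : bool := (flat_space Y <= flat_space X)%VS.

Fact flat_le_refl : reflexive flat_le.
Proof. by move=> X; apply: subvv. Qed.

Fact flat_le_anti : antisymmetric flat_le.
Proof.
by move=> X Y /andP[YX XY]; apply/val_inj/eqP; rewrite eqEsubv; apply/andP.
Qed.

Fact flat_le_trans : transitive flat_le.
Proof. by move=> Y X Z YX ZY; apply: subv_trans ZY YX. Qed.

Fact flat_display : Order.disp_t. Proof. exact: Order.Disp tt tt. Qed.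

HB.instance Definition _ := Order.Le_isPOrder.Build flat_display braid_flat
  flat_le_refl flat_le_anti flat_le_trans.

Lemma flat_leE (X Y : braid_flat) :
  (X <= Y)%O = (flat_space Y <= flat_space X)%VS.
Proof. by []. Qed.

Definition codim (X : braid_flat) : nat := (n - \dim (flat_space X))%N.

Variable P : rel 'I_n.

Definition in_cone x : Prop := forall i j, P i j -> i != j -> x 0 i < x 0 j.

Definition interior_flat (X : braid_flat) : bool :=
  `[< exists2 x, x \in flat_space X & in_cone x >].

Definition whitney (k : nat) : nat :=
  \sum_(X : braid_flat | interior_flat X && (codim X == k))
    `|mobius ambient_flat X|%N.

(* The sum may stop at [n] since codimensions are at most [n]. *)
Definition Poin : {poly int} := \sum_(k < n.+1) (whitney k)%:R *: 'X^k.

End Braid.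

Section Transverse.
Variables (n : nat) (P : rel 'I_n).
Implicit Types (B C : {set 'I_n}) (pi : {set {set 'I_n}}) (s : {perm 'I_n}).

(* [s] is the word [s 0, ..., s (n-1)], so that [s^-1 i] is the position of
   [i] in it. *)
Definition linear_extension s : bool :=
  [forall i, forall j, (P i j && (i != j)) ==> ((s^-1)%g i < (s^-1)%g j)%N].

Definition linear_extensions : {set {perm 'I_n}} := [set s | linear_extension s].

Definition antichain B : bool :=
  [forall p in B, forall q in B, P p q ==> (p == q)].

Definition quotient_step pi : rel {set 'I_n} := fun B C =>
  [&& B \in pi, C \in pi & [exists p in B, exists q in C, P p q]].

(* [connect] is the reflexive transitive closure; as [P] is reflexive and
   blocks are nonempty, on [pi] it is the transitive closure. *)
Definition quotient_le pi : rel {set 'I_n} := connect (quotient_step pi).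

Definition transverse pi : bool :=
  [forall B in pi, antichain B] &&
  [forall B in pi, forall C in pi, (quotient_le pi B C && quotient_le pi C B) ==> (B == C)].

Definition transverse_perms : {set {perm 'I_n}} := [set s | transverse (porbits s)].

End Transverse.

(* Main.v *)
(** To a permutation [s] attach the flat [F s] of all vectors constant on the
    cycles of [s]; its codimension is [n] minus the number of cycles. The sum
    of the signs of all [s] with [F s] containing [X] vanishes unless [X] is the
    whole space: if [X] lies in the hyperplane [x_a = x_b], multiplication by the
    transposition [(a b)] is a sign-reversing involution. Hence
    [mu (V, X)] is the sum of the signs of the [s] with [F s = X], and these
    signs all agree. As [F s] meets the cone of [P] exactly when [s] is
    [P]-transverse, this gives the formula for the Poincare polynomial.

    For the count, replace [P] by an arbitrary relation [Q], and call [s]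
    transverse when some map increasing along [Q] is constant on its cycles.
    Imposing either [a < b] or [b < a] splits the linear extensions of [Q] in
    two. The transverse permutations with [a] and [b] in different cycles are
    transverse for at least one of the two relations, and they are transverse
    for both exactly when multiplication by [(a b)] produces a transverse
    permutation with [a] and [b] in the same cycle. So both counts satisfy the
    same recursion, and they agree on tournaments, where each is 0 or 1. *)
From HB Require Import structures.
Require Import Defs.
From mathcomp Require Import all_boot all_order all_fingroup all_algebra.
From mathcomp Require Import boolp reals zify.

Set Implicit Arguments.
Unset Strict Implicit.
Unset Printing Implicit Defensive.

Import Order.TTheory GRing.Theory Num.Theory.
Local Open Scope ring_scope.

(** * Functions constant on the cycles of a permutation *)

Section PermInvariance.
Variables (T : finType).
Implicit Types (s : {perm T}) (a b i j : T).

Lemma porbit_invariant (U : Type) (f : T -> U) s :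
  (forall i, f (s i) = f i) -> forall i j, j \in porbit s i -> f j = f i.
Proof.
move=> fs i j /porbitP[k ->]; elim: k => [|k IHk]; first by rewrite perm1.
by rewrite expgSr permM fs.
Qed.

(** Multiplication by [(a b)] merges or splits cycles according to whether [a] and [b] share one.
    Doing it twice restores [s], so the two changes in the number of cycles cancel. *)
Lemma porbit_tperm_mul s a b :
  a != b -> (a \in porbit (tperm a b * s) b) = (a \notin porbit s b).
Proof.
move=> ab; have := porbits_mul_tperm s a b.
have := porbits_mul_tperm (tperm a b * s)%g a b.
rewrite /= mulgA tperm2 mul1g ab.
by case: (a \in porbit s b); case: (a \in porbit _ b) => //=; lia.
Qed.

Lemma tperm_mul_invariant (U : Type) (f : T -> U) s a b :
    a != b -> a \notin porbit s b ->
  (forall i, f ((tperm a b * s)%g i) = f i) <->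
  (forall i, f (s i) = f i) /\ f a = f b.
Proof.
move=> ab nab; have tf : f a = f b -> forall i, f (tperm a b i) = f i.
  by move=> fab i; case: tpermP => // ->.
split=> [fts | [fs fab] i]; last by rewrite permM fs tf.
have fab : f a = f b.
  by apply: (porbit_invariant fts); rewrite porbit_tperm_mul.
by split=> // i; rewrite -[in LHS](tpermK a b i) -permM fts tf.
Qed.

End PermInvariance.

(** * Permutations preserving an increasing map *)

Section Increasing.
Variable T : finType.
Implicit Types (Q : rel T) (s : {perm T}) (x : T -> nat) (a b i j : T).

Definition increasing Q x := forall i j, Q i j -> (x i < x j)%N.

(** [x] plays the role of a point of the cone that lies on the flat of [s]. [Q] is an arbitrary
    relation, so that pairs can be added without closing it under transitivity. *)
Definition fixes_increasing Q s : Prop :=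
  exists2 x, increasing Q x & forall i, x (s i) = x i.

Definition increasing_perms Q : {set {perm T}} :=
  [set s | `[< fixes_increasing Q s >]].

Definition add_rel Q a b : rel T :=
  [rel i j | Q i j || (i == a) && (j == b)].

Lemma increasing_add_rel Q a b x :
  increasing (add_rel Q a b) x <-> increasing Q x /\ (x a < x b)%N.
Proof.
split=> [Qx | [Qx xab] i j /= /orP[/Qx //|/andP[/eqP-> /eqP->]] //].
by split=> [i j Qij|]; apply: Qx; rewrite /add_rel /= ?Qij ?eqxx ?orbT.
Qed.

(* Doubling [x] leaves room to raise the cycle of [b] by one. *)
Lemma separate_cycles Q s a b x :
    a \notin porbit s b -> increasing Q x -> (forall i, x (s i) = x i) ->
    x a = x b -> fixes_increasing (add_rel Q a b) s.
Proof.
move=> nab Qx xs xab.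
exists (fun i => (x i).*2 + (i \in porbit s b))%N; last first.
  by move=> i; rewrite xs -!eq_porbit_mem -[s i]/((s ^+ 1)%g i) porbit_perm.
apply/increasing_add_rel; split; last by rewrite xab (negPf nab) porbit_id; lia.
by move=> i j /Qx; lia.
Qed.

Lemma increasing_permsU Q a b : a != b ->
  increasing_perms (add_rel Q a b) :|: increasing_perms (add_rel Q b a)
  = [set s in increasing_perms Q | a \notin porbit s b].
Proof.
move=> ab; apply/setP=> s; rewrite !inE.
apply/orP/andP => [|[/asboolP[x Qx xs] nab]].
  case=> /asboolP[x /increasing_add_rel[Qx xab] xs]; split;
    do ?[by apply/asboolP; exists x]; apply/negP => /(porbit_invariant xs) xE;
    by rewrite xE ltnn in xab.
case: (ltngtP (x a) (x b)) => xab.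
- by left; apply/asboolP; exists x => //; apply/increasing_add_rel.
- by right; apply/asboolP; exists x => //; apply/increasing_add_rel.
by left; apply/asboolP; apply: separate_cycles xab.
Qed.

(** Two invariant maps that order [a] and [b] oppositely combine into one with a tie, which
    [(a b) s] preserves. Conversely, a tie between different cycles can be broken either way. *)
Lemma increasing_permsI Q a b : a != b ->
  increasing_perms (add_rel Q a b) :&: increasing_perms (add_rel Q b a)
  = mulg (tperm a b) @^-1: [set s in increasing_perms Q | a \in porbit s b].
Proof.
move=> ab; apply/setP=> s; rewrite !inE porbit_tperm_mul //.
have sep x : (forall i, x (s i) = x i) -> (x a < x b)%N -> a \notin porbit s b.
  by move=> xs; apply: contraTN => /(porbit_invariant xs) ->; rewrite ltnn.
apply/andP/andP.
  case=> /asboolP[x /increasing_add_rel[Qx xab] xs].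
  case=> /asboolP[y /increasing_add_rel[Qy yba] ys].
  have nab := sep _ xs xab; split=> //; apply/asboolP.
  (* where the segment from [x] to [y] crosses the hyperplane of [a] and [b] *)
  exists (fun i => (y a - y b) * x i + (x b - x a) * y i)%N.
    by move=> i j Qij; have := Qx _ _ Qij; have := Qy _ _ Qij; nia.
  apply/tperm_mul_invariant => //; split; first by move=> i; rewrite xs ys.
  nia.
case=> /asboolP[x Qx /tperm_mul_invariant+] nab.
case=> // xs xab; split; apply/asboolP.
  exact: separate_cycles xab.
by apply: (@separate_cycles _ _ _ _ x); rewrite // porbit_sym.
Qed.

Lemma card_increasing_perms_split Q a b : a != b ->
  #|increasing_perms Q| = (#|increasing_perms (add_rel Q a b)|
                           + #|increasing_perms (add_rel Q b a)|)%N.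
Proof.
(* The union counts the permutations with [a] and [b] in different cycles; the intersection, through
   the bijection [s |-> (a b) s], counts the others. *)
move=> ab; rewrite -cardsUI increasing_permsU // increasing_permsI //.
rewrite card_preimset; last exact: mulgI.
rewrite -(cardsID [set s | a \in porbit s b] (increasing_perms Q)) addnC.
by congr addn; apply: eq_card => s; rewrite !inE // andbC.
Qed.

End Increasing.

(** * Linear extensions of a relation and their number *)

Section LinearExtensions.
Variable n : nat.
Implicit Types (Q : rel 'I_n) (s : {perm 'I_n}) (x : 'I_n -> nat).

Definition sorting_perms Q : {set {perm 'I_n}} :=
  [set s : {perm 'I_n} | `[< increasing Q (fun i => (s^-1)%g i) >]].

Lemma card_sorting_perms_split Q a b : a != b ->
  #|sorting_perms Q| = (#|sorting_perms (add_rel Q a b)|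
                        + #|sorting_perms (add_rel Q b a)|)%N.
Proof.
move=> ab; rewrite -cardsUI [X in _ = (_ + X)%N]eq_card0 ?addn0; last first.
  move=> s; rewrite !inE; apply/andP => -[/asboolP/increasing_add_rel[_ sab]].
  by case/asboolP/increasing_add_rel => _ /(ltn_trans sab); rewrite ltnn.
apply: eq_card => s; rewrite !inE.
apply/asboolP/orP => [Qs | [] /asboolP/increasing_add_rel[] //].
case: (ltngtP ((s^-1)%g a) ((s^-1)%g b)) => [sab|sba|/val_inj/perm_inj/eqP].
- by left; apply/asboolP/increasing_add_rel.
- by right; apply/asboolP/increasing_add_rel.
by rewrite (negPf ab).
Qed.

Lemma sort_injective x : injective x ->
  exists s : {perm 'I_n}, forall i j,
    (x i < x j)%N -> ((s^-1)%g i < (s^-1)%g j)%N.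
Proof.
(* The size of [A i] is the rank of [x i], which becomes the position of [i]. *)
move=> x_inj; pose A i := [set k | (x k < x i)%N].
have ltA i j : (x i < x j)%N -> (#|A i| < #|A j|)%N.
  move=> xij; apply: proper_card; apply/properP; split.
    by apply/subsetP => k; rewrite !inE => /ltn_trans; apply.
  by exists i; rewrite !inE ?ltnn.
have ltn i : (#|A i| < n)%N.
  rewrite -[X in (_ < X)%N]card_ord -cardsT; apply: proper_card.
  by apply/properP; split; [apply: subsetT | exists i; rewrite !inE ?ltnn].
have r_inj : injective (fun i => Ordinal (ltn i)).
  move=> i j [eqA]; apply: x_inj.
  by case: (ltngtP (x i) (x j)) => // /ltA; rewrite eqA ltnn.
by exists (perm r_inj)^-1%g => i j /ltA; rewrite invgK !permE.
Qed.

(** Loops, opposite pairs and longer cycles are allowed; with any of them no map increases along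
    [Q], and both counts are 0. *)
Definition tournament Q := forall i j, i != j -> Q i j || Q j i.

Lemma increasing_inj Q x : tournament Q -> increasing Q x -> injective x.
Proof.
move=> tourQ Qx i j xij; apply/eqP/negPn/negP => /tourQ/orP[] /Qx;
by rewrite xij ltnn.
Qed.

Lemma tournament_increasing_perms Q :
  tournament Q -> #|increasing_perms Q| = #|sorting_perms Q|.
Proof.
move=> tourQ.
have sub1 s : s \in increasing_perms Q -> s = 1%g.
  rewrite inE => /asboolP[x Qx xs]; apply/permP => i; rewrite perm1.
  exact: (increasing_inj tourQ Qx).
have uniq s t : s \in sorting_perms Q -> t \in sorting_perms Q -> s = t.
  rewrite !inE => /asboolP Qs /asboolP Qt.
  (* The elements before [i] in the word are exactly its [Q]-predecessors, so [Q] determines every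
     position. *)
  have pos (u : {perm 'I_n}) i : increasing Q (fun i => (u^-1)%g i) ->
      ((u^-1)%g i : nat) = #|[set j | Q j i]|.
    move=> Qu; rewrite -[LHS]card_ord.
    have wd_inj : injective (widen_ord (ltnW (ltn_ord ((u^-1)%g i)))).
      by move=> k l /(congr1 val)/= /val_inj.
    rewrite -cardsT -(card_imset _ wd_inj) -(card_imset _ (@perm_inj _ u)).
    congr #|pred_of_set _|; apply/setP => j; rewrite inE.
    apply/imsetP/idP => [[_ /imsetP[k _ ->] ->]|Qji].
      set j' := widen_ord _ _.
      have lt_j' : (j' < (u^-1)%g i)%N by apply: (ltn_ord k).
      have /tourQ/orP[//|/Qu] : u j' != i.
        by move: lt_j'; apply: contraTneq => <-; rewrite permK ltnn.
      by rewrite permK ltnNge ltnW.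
    exists ((u^-1)%g j); last by rewrite permKV.
    by apply/imsetP; exists (Ordinal (Qu _ _ Qji)) => //; apply: val_inj.
  by apply: invg_inj; apply/permP => i; apply: val_inj; rewrite /= !pos.
have [[x Qx]|noQ] := pselect (exists x, increasing Q x); last first.
  rewrite !eq_card0 // => s; rewrite inE; apply/negbTE/asboolP.
    by move=> Qs; apply: noQ; eexists; apply: Qs.
  by case=> x Qx _; apply: noQ; exists x.
have [s s_mono] := sort_injective (increasing_inj tourQ Qx).
have sQ : s \in sorting_perms Q.
  by rewrite inE; apply/asboolP => i j /Qx/s_mono.
transitivity #|[set 1%g : {perm 'I_n}]|.
  congr #|pred_of_set _|; apply/setP => t; rewrite in_set1.
  apply/idP/eqP => [/sub1 //|->]; rewrite inE; apply/asboolP.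
  by exists x => // i; rewrite perm1.
rewrite cards1 -(cards1 s); congr #|pred_of_set _|; apply/setP => t.
by rewrite in_set1; apply/eqP/idP => [->|tQ] //; apply: uniq.
Qed.

Lemma card_sorting_perms Q : #|sorting_perms Q| = #|increasing_perms Q|.
Proof.
(* Induction on the number of pairs left unrelated in both directions. *)
pose missing Q :=
  [set e : 'I_n * 'I_n | [&& e.1 != e.2, ~~ Q e.1 e.2 & ~~ Q e.2 e.1]].
have [m] := ubnP #|missing Q|; elim: m => // m IHm in Q *; rewrite ltnS => leQm.
have [M0|[[a b] /[dup] Mab]] := set_0Vmem (missing Q).
  apply/esym/tournament_increasing_perms => i j ij; apply: contraT.
  rewrite negb_or => nQ; have : (i, j) \in missing Q by rewrite inE ij.
  by rewrite M0 inE.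
rewrite inE /= => /and3P[ab nQab nQba].
have lt_missing c d : ((c, d) == (a, b)) || ((c, d) == (b, a)) ->
    (#|missing (add_rel Q c d)| < m)%N.
  move=> cd; apply: leq_trans leQm; apply: proper_card; apply/properP; split.
    apply/subsetP => -[i j]; rewrite !inE /add_rel /= !negb_or.
    by case/and3P=> -> /andP[-> _] /andP[-> _].
  exists (a, b) => //; rewrite inE /add_rel /=.
  by case/orP: cd => /eqP[-> ->]; rewrite !eqxx !orbT ?andbF.
rewrite (card_sorting_perms_split Q ab) (card_increasing_perms_split Q ab).
by rewrite !IHm ?lt_missing ?eqxx ?orbT.
Qed.

End LinearExtensions.

(** * Transversality in terms of increasing maps *)

Section TransversePerms.
Variables (n : nat) (P : rel 'I_n).

Definition strict_part : rel 'I_n := [rel i j | P i j && (i != j)].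

Lemma linear_extensionsE : linear_extensions P = sorting_perms strict_part.
Proof.
apply/setP => s; rewrite !inE; apply/forallP/asboolP => [sP i j Pij|sP i].
  by have /forallP/(_ j)/implyP := sP i; apply.
by apply/forallP => j; apply/implyP => /sP.
Qed.

Lemma transverse_permsE : transverse_perms P = increasing_perms strict_part.
Proof.
apply/setP => s; rewrite !inE; apply/idP/asboolP => [|[x Px xs]].
  case/andP => /forallP/= antiP /forallP/= ltP.
  have orb i : porbit s i \in porbits s by apply: imset_f.
  (* The increasing map sends [i] to the number of blocks below its own block in the quotient. *)
  pose down (B : {set 'I_n}) :=
    [set C in porbits s | quotient_le P (porbits s) C B].
  exists (fun i => #|down (porbit s i)|); last first.
    by move=> i; rewrite -[s i]/((s ^+ 1)%g i) porbit_perm.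
  move=> i j /andP[Pij ij].
  have le_ij : quotient_le P (porbits s) (porbit s i) (porbit s j).
    apply: connect1; rewrite /quotient_step !orb /=.
    apply/existsP; exists i; rewrite porbit_id; apply/existsP; exists j.
    by rewrite porbit_id.
  apply: proper_card; apply/properP; split.
    apply/subsetP => C; rewrite !inE => /andP[-> leCi].
    exact: connect_trans leCi le_ij.
  exists (porbit s j); rewrite !inE orb /=; first exact: connect0.
  (* Antisymmetry of the quotient would put [i] and [j] in one block, which is an antichain. *)
  apply: contra ij => le_ji.
  have := ltP (porbit s i); rewrite orb /= => /forallP/(_ (porbit s j)).
  rewrite orb le_ij le_ji /= => /eqP ij_orb.
  have := antiP (porbit s i); rewrite orb /= => /forallP/(_ i).
  by rewrite porbit_id /= => /forallP/(_ j); rewrite ij_orb porbit_id Pij.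
(* [x] is constant on each block, so the maximum merely names its value there. *)
pose X (B : {set 'I_n}) := \max_(p in B) x p.
have XE i p : p \in porbit s i -> x p = X (porbit s i).
  move=> pi; apply/eqP; rewrite eqn_leq leq_bigmax_cond //=.
  apply/bigmax_leqP => q qi.
  by rewrite (porbit_invariant xs qi) (porbit_invariant xs pi).
have le_lt B C : quotient_le P (porbits s) B C -> B = C \/ (X B < X C)%N.
  case/connectP => r; elim: r B => [|D r IHr] B /=; first by left.
  case/andP=> /and3P[/imsetP[i _ ->] /imsetP[j _ ->]].
  case/existsP=> p /andP[pi /existsP[q /andP[qj Ppq]]] path_r last_r.
  have ij : porbit s i = porbit s j \/ (X (porbit s i) < X (porbit s j))%N.
    (* A step through [p = q] stays in one block; any other step strictly increases [X]. *)
    have [pq|pq] := eqVneq p q; last first.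
      by right; rewrite -(XE _ _ pi) -(XE _ _ qj) Px // /strict_part /= Ppq.
    left; move: pi qj; rewrite pq -!eq_porbit_mem => /eqP<- /eqP<- //.
  have [<- //|jC] := IHr _ path_r last_r; right.
  by case: ij => [-> //|/ltn_trans]; apply.
apply/andP; split.
  apply/forallP => B; apply/implyP => /imsetP[i _ ->{B}].
  apply/forallP => p; apply/implyP => pi.
  apply/forallP => q; apply/implyP => qi; apply/implyP => Ppq.
  apply: contraT => pq.
  suff: (x p < x q)%N by rewrite (XE _ _ pi) (XE _ _ qi) ltnn.
  by rewrite Px // /strict_part /= Ppq.
apply/forallP => B; apply/implyP => _; apply/forallP => C; apply/implyP => _.
apply/implyP => /andP[/le_lt[-> //|ltBC] /le_lt[-> //|]].
by move/(ltn_trans ltBC); rewrite ltnn.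
Qed.

End TransversePerms.

(** * Flats fixed by permutations, the Möbius function and the Poincaré polynomial *)

Section FixedFlat.
Variables (R : realType) (n : nat).
Implicit Types (s : {perm 'I_n}) (X Y Z : braid_flat R n) (v : 'rV[R]_n).

Lemma mem_bigcap_hyp (E : {set 'I_n * 'I_n}) v :
  (v \in (\bigcap_(e | e \in E) braid_hyp R e.1 e.2)%VS)
  = [forall e in E, v 0 e.1 == v 0 e.2].
Proof.
rewrite memvE; apply/subv_bigcapP/forallP => /= vE e.
  by apply/implyP => /vE; rewrite -memvE mem_braid_hyp.
by move=> eE; rewrite -memvE mem_braid_hyp; have /implyP := vE e; apply.
Qed.

Definition fixed_hyps s : {set 'I_n * 'I_n} :=
  [set e : 'I_n * 'I_n | (e.1 < e.2)%N & e.2 \in porbit s e.1].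

Lemma fixed_flat_subproof s :
  (\bigcap_(e | e \in fixed_hyps s) braid_hyp R e.1 e.2)%VS \in braid_flats R n.
Proof.
apply/imageP; exists (fixed_hyps s) => //.
by rewrite powersetE; apply/subsetP => e; rewrite !inE => /andP[].
Qed.

Definition fixed_flat s : braid_flat R n := SeqSub (fixed_flat_subproof s).

Lemma mem_fixed_flat s v :
  reflect (forall i, v 0 (s i) = v 0 i) (v \in flat_space (fixed_flat s)).
Proof.
rewrite /flat_space /= mem_bigcap_hyp; apply: (iffP forallP) => [vE i|vs e].
  have si : s i \in porbit s i by apply: (mem_porbit s 1).
  case: (ltngtP i (s i)) => [lt_is|lt_si|/val_inj <- //].
    by have := vE (i, s i); rewrite inE lt_is si => /eqP.
  by have := vE (s i, i); rewrite inE lt_si /= porbit_sym si => /eqP.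
apply/implyP; rewrite inE => /andP[_ e12].
by rewrite (porbit_invariant vs e12).
Qed.

Lemma dim_fixed_flat s : \dim (flat_space (fixed_flat s)) = #|porbits s|.
Proof.
have orb i : porbit s i \in porbits s by apply: imset_f.
pose rk i := enum_rank_in (orb i) (porbit s i).
have rkK i : enum_val (rk i) = porbit s i by apply: enum_rankK_in.
pose f (u : 'rV[R]_#|porbits s|) : 'rV[R]_n := \row_i u 0 (rk i).
have f_lin : linear f by move=> a u v; apply/rowP => i; rewrite !mxE.
pose fL := GRing.isLinear.Build _ _ _ _ f f_lin.
pose F : {linear 'rV[R]_#|porbits s| -> 'rV[R]_n} := HB.pack f fL.
have repr (k : 'I_#|porbits s|) : exists i, k = rk i.
  have /imsetP[i _ ik] := enum_valP k; exists i.
  by apply: enum_val_inj; rewrite rkK.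
(* Assigning one free coordinate to each cycle parametrises the flat; [F] is injective because every
   cycle is some [rk i]. *)
have -> : flat_space (fixed_flat s) = (linfun F @: fullv)%VS.
  apply/vspaceP => v; apply/mem_fixed_flat/memv_imgP => [vs|[u _ ->] i].
    have ex k : exists i, k == rk i by have [i ->] := repr k; exists i.
    exists (\row_k v 0 (xchoose (ex k))); first exact: memvf.
    rewrite lfunE; apply/rowP => i; rewrite !mxE.
    have /eqP/(congr1 enum_val) := xchooseP (ex (rk i)); rewrite !rkK => /eqP.
    by rewrite eq_porbit_mem => /(porbit_invariant vs).
  rewrite lfunE /= !mxE; congr (u 0 _); apply: enum_val_inj.
  by rewrite !rkK -[s i]/((s ^+ 1)%g i) porbit_perm.
rewrite limg_dim_eq; first by rewrite dimvf /dim /= mul1n.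
apply/eqP; rewrite capfv -subv0; apply/subvP => u.
rewrite memv_ker lfunE memv0 => /eqP Fu.
apply/eqP/rowP => k; have [i ->] := repr k.
by have /rowP/(_ i) := Fu; rewrite !mxE.
Qed.

Lemma card_porbits_le s : (#|porbits s| <= n)%N.
Proof.
rewrite -dim_fixed_flat; apply: leq_trans (dimvS (subvf _)) _.
by rewrite dimvf /dim /= mul1n.
Qed.

Lemma codim_fixed_flat s : codim (fixed_flat s) = (n - #|porbits s|)%N.
Proof. by rewrite /codim dim_fixed_flat. Qed.

Lemma sign_perm_codim s : (-1) ^+ s = (-1) ^+ codim (fixed_flat s) :> int.
Proof.
rewrite codim_fixed_flat -[RHS]signr_odd oddB ?card_porbits_le //.
by rewrite /odd_perm card_ord.
Qed.

Lemma sum_sign_fixed_flat_le X : X != ambient_flat R n ->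
  \sum_(s | (fixed_flat s <= X)%O) (-1) ^+ s = 0 :> int.
Proof.
move=> X_amb; have [a [b [ab Xab]]] :
    exists a b, a != b /\ forall v, v \in flat_space X -> v 0 a = v 0 b.
  have /imageP[E] := valP X; rewrite powersetE => /subsetP E_lt XE.
  have [E0|[[a b] abE]] := set_0Vmem E.
    by case/eqP: X_amb; apply: val_inj; rewrite /= XE E0 big_set0.
  exists a, b; split.
    have := E_lt _ abE; rewrite inE.
    by apply: contraTneq => ->; rewrite ltnn.
  move=> v; rewrite /flat_space XE mem_bigcap_hyp => /forallP/(_ (a, b)).
  by rewrite abE => /eqP.
have le_tperm s :
    (fixed_flat s <= X)%O -> (fixed_flat (tperm a b * s)%g <= X)%O.
  rewrite !flat_leE => /subvP sX; apply/subvP => v vX; apply/mem_fixed_flat => i.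
  have /mem_fixed_flat vs := sX v vX; rewrite permM vs.
  by case: tpermP => // ->; rewrite Xab.
suff : \sum_(s | (fixed_flat s <= X)%O) (-1) ^+ s
       = - (\sum_(s | (fixed_flat s <= X)%O) (-1) ^+ s) :> int by lia.
rewrite [LHS](reindex_inj (mulgI (tperm a b))) -sumrN; apply: eq_big => s.
  apply/idP/idP => [/le_tperm|/le_tperm //].
  by rewrite mulgA tperm2 mul1g.
by move=> _; rewrite odd_mul_tperm ab signr_addb mulN1r.
Qed.

Lemma fixed_flat_ambient s : (fixed_flat s == ambient_flat R n) = (s == 1%g).
Proof.
apply/eqP/eqP => [sV|->].
  apply/permP => i; rewrite perm1; apply/eqP.
  (* The basis vector at [i] is nonzero only at [i], so its invariance forces [s i = i]. *)
  have /mem_fixed_flat/(_ i) : delta_mx 0 i \in flat_space (fixed_flat s).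
    by rewrite sV; apply: memvf.
  rewrite !mxE !eqxx /=; case: (s i == i) => // /eqP.
  by rewrite eq_sym oner_eq0.
apply/val_inj/vspaceP => v; rewrite memvf.
by apply/mem_fixed_flat => i; rewrite perm1.
Qed.

Lemma ambient_flat_le X : (ambient_flat R n <= X)%O.
Proof. exact: subvf. Qed.

(** Both sides are 1 at the whole space and sum to 0 over the flats below any other [X]; induction
    on the number of flats strictly below [X]. *)
Lemma mobius_ambientE X :
  mobius (ambient_flat R n) X = \sum_(s | fixed_flat s == X) (-1) ^+ s.
Proof.
have [m] := ubnP #|[set Z | (Z < X)%O]|; elim: m => // m IHm in X *.
rewrite ltnS => leXm; have [->|X_amb] := eqVneq X (ambient_flat R n).
  by rewrite mobiusxx (eq_bigl _ _ fixed_flat_ambient) big_pred1_eq odd_perm1.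
rewrite mobiusE 1?eq_sym //; apply/eqP; rewrite eq_sym -addr_eq0; apply/eqP.
rewrite (eq_bigr (fun Z => \sum_(s | fixed_flat s == Z) (-1) ^+ s)); last first.
  move=> Z /andP[_ ltZX]; apply: IHm; apply: leq_trans leXm.
  apply: proper_card; apply/properP; split; last by exists Z; rewrite !inE ?ltxx.
  by apply/subsetP => W; rewrite !inE => /lt_trans; apply.
have := sum_sign_fixed_flat_le X_amb.
rewrite (partition_big fixed_flat (fun Z => Z <= X)%O) // (bigD1 X) //=.
apply: etrans; congr (_ + _).
  by apply: eq_bigl => s; case: eqP => [->|]; rewrite ?lexx ?andbF.
apply: eq_big => Z; first by rewrite ambient_flat_le lt_neqAle /= andbC.
case/andP => _ ltZX; apply: eq_bigl => s.
by case: eqP => [->|_]; rewrite ?andbF ?(ltW ltZX).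
Qed.

Lemma abs_mobius_ambient X :
  `|mobius (ambient_flat R n) X|%N = #|[set s | fixed_flat s == X]|.
Proof.
rewrite mobius_ambientE (eq_bigr (fun=> (-1) ^+ codim X)); last first.
  by move=> s /eqP <-; apply: sign_perm_codim.
by rewrite sumr_const -mulr_natl abszM absz_sign muln1 natz cardsE.
Qed.

Lemma interior_fixed_flat (P : rel 'I_n) s :
  interior_flat P (fixed_flat s) = (s \in increasing_perms (strict_part P)).
Proof.
rewrite inE; apply: asbool_equiv_eq; split=> [[v /mem_fixed_flat vs vP]|[x xP xs]].
  (* Ranks replace real coordinates by natural numbers, keeping ties and strict inequalities. *)
  exists (fun i => #|[set k | v 0 k < v 0 i]|); last first.
    by move=> i; congr #|pred_of_set _|; apply/setP => k; rewrite !inE vs.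
  move=> i j /andP[Pij ij]; have vij := vP i j Pij ij.
  apply: proper_card; apply/properP; split.
    by apply/subsetP => k; rewrite !inE => /lt_trans; apply.
  by exists i; rewrite !inE ?ltxx.
exists (\row_i (x i)%:R).
  by apply/mem_fixed_flat => i; rewrite !mxE xs.
by move=> i j Pij ij; rewrite !mxE ltr_nat xP // /strict_part /= Pij.
Qed.

Lemma Poin_transverse (P : rel 'I_n) :
  Poin R P = \sum_(s in transverse_perms P) 'X^(n - #|porbits s|).
Proof.
rewrite transverse_permsE (partition_big fixed_flat (interior_flat P)); last first.
  by move=> s; rewrite interior_fixed_flat.
have whitneyE k : (whitney R P k)%:R *: 'X^k =
    \sum_(X : braid_flat R n | interior_flat P X && (codim X == k))
      (`|mobius (ambient_flat R n) X|%N)%:R *: 'X^k :> {poly int}.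
  by rewrite -scaler_suml -[in RHS]natr_sum.
rewrite /Poin (eq_bigr _ (fun (k : 'I_n.+1) _ => whitneyE k)).
(* With the sum over flats outside, each flat contributes only at [k = codim X], and its coefficient
   counts the permutations fixing exactly that flat. *)
rewrite (exchange_big_dep (interior_flat P)) /=; last by move=> k X _ /andP[].
apply: eq_bigr => X PX.
have ltX : (codim X < n.+1)%N by rewrite ltnS leq_subr.
rewrite (big_pred1 (Ordinal ltX)) => [|k]; last by rewrite PX /= eq_sym.
rewrite abs_mobius_ambient /= -sumr_const scaler_suml.
apply: eq_big => s; last first.
  by rewrite inE => /eqP<-; rewrite scale1r codim_fixed_flat.
by rewrite [LHS]inE -interior_fixed_flat; case: eqP => [->|]; rewrite ?PX ?andbF.
Qed.

End FixedFlat.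

Theorem theorem1p1 (R : realType) (n : nat) (P : rel 'I_n)
    (Prefl : reflexive P) (Panti : antisymmetric P) (Ptrans : transitive P) :
  Poin R P = \sum_(s in transverse_perms P) 'X^(n - #|porbits s|)
  /\ #|linear_extensions P| = #|transverse_perms P|.
Proof.
split; first exact: Poin_transverse.
by rewrite linear_extensionsE transverse_permsE card_sorting_perms.
Qed.
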